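(* Let $\mu$ be a nontrivial probability measure on $\partial\mathbb{D}$, $d\mu_t(\theta)=e^{2t\cos\theta}d\mu(\theta)/\int e^{2t\cos\theta}d\mu(\theta)$, and $\alpha_n(t)=\alpha_n(\mu_t)$. Let $\Theta=\Theta(\mu)$ and suppose $S=\{\theta\in(-\pi,\pi]:|\theta|<\Theta,\ e^{i\theta}\in\mathrm{supp}\,\mu\}$ is infinite. Number the points of $S$ as $\theta_0,\theta_1,\theta_2,\dots$ with $|\theta_0|\le|\theta_1|\le|\theta_2|\le\cdots$. Then, as $t\to\infty$: (i) if $|\theta_{j-1}|<|\theta_j|<|\theta_{j+1}|$ (for $j=0$: if $|\theta_0|<|\theta_1|$), then $\alpha_j(t)\to(-1)\prod_{k=0}^j(-e^{-i\theta_k})$; (ii) if $|\theta_j|=|\theta_{j+1}|$, then \[ \alpha_j(t)\to\Bigl[\prod_{k=0}^{j-1}(-e^{-i\theta_k})\Bigr]\bigl[a e^{-i\theta_j}+(1-a)e^{i\theta_j}\bigr],\qquad a=\frac{\beta_+}{\beta_++\beta_-}, \] where $\beta_\pm=\prod_{k=0}^{j-1}|e^{\pm i\theta_j}-e^{i\theta_k}|^2\,\mu(\{e^{\pm i\theta_j}\})$.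
   Context: A measure is nontrivial if its support is infinite. For a probability measure $\nu$ on $\partial\mathbb{D}$ with monic orthogonal polynomials $\Phi_n(z;\nu)$, the Verblunsky coefficients are $\alpha_n(\nu)=-\overline{\Phi_{n+1}(0;\nu)}$. $\sigma_{\mathrm{ess}}(\mu)$ is the set of non-isolated points of $\mathrm{supp}\,\mu$, and $\Theta(\mu)=\min\{|\theta|:\theta\in(-\pi,\pi],\ e^{i\theta}\in\sigma_{\mathrm{ess}}(\mu)\}$. The functions $\alpha_n(t)$ solve the Schur flow $\alpha_n'=(1-|\alpha_n|^2)(\alpha_{n+1}-\alpha_{n-1})$ with $\alpha_{-1}\equiv-1$. Empty products equal $1$. *)

(* Defs.v *)
From HB Require Import structures.
From mathcomp Require Import all_boot all_order all_algebra.
From mathcomp Require Import all_classical all_reals all_analysis.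
From mathcomp Require Import complex.

Set Implicit Arguments.
Unset Strict Implicit.
Unset Printing Implicit Defensive.
Import Order.TTheory GRing.Theory Num.Theory.
Import numFieldNormedType.Exports.
Local Open Scope classical_set_scope.
Local Open Scope ring_scope.
Local Open Scope complex_scope.

Section OPUC.
Variable R : realType.

Definition expi (th : R) : R[i] := (cos th) +i* (sin th).

Definition Cintegral (mu : {measure set R -> \bar R}) (f : R -> R[i]) : R[i] :=
  (Rintegral mu setT (fun th => complex.Re (f th))) +i*
  (Rintegral mu setT (fun th => complex.Im (f th))).

(* The measure  w(theta) d mu(theta)  (w >= 0 a density w.r.t. mu).
   A monic polynomial p of degree n is orthogonal (in L^2(w dmu)) to
   1, z, ..., z^(n-1):  int conj(z^k) p(z) w dmu = 0  for k < n. *)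
Definition monic_orth (mu : {measure set R -> \bar R}) (w : R -> R) (n : nat)
    (p : {poly R[i]}) : Prop :=
  [/\ size p = n.+1, p \is monic &
      forall k : nat, (k < n)%N ->
        Cintegral mu (fun th => (w th)%:C * ((expi th) ^+ k)^* * p.[expi th]) = 0].

Definition Phi (mu : {measure set R -> \bar R}) (w : R -> R) (n : nat)
  : {poly R[i]} := xget 0 (monic_orth mu w n).

Definition verblunsky (mu : {measure set R -> \bar R}) (w : R -> R) (n : nat)
  : R[i] := - ((Phi mu w n.+1).[0])^*.

Definition tilt_density (mu : {measure set R -> \bar R}) (t : R) : R -> R :=
  fun th => expR (2 * t * cos th) /
            Rintegral mu setT (fun s => expR (2 * t * cos s)).

Definition alpha_t (mu : {measure set R -> \bar R}) (n : nat) (t : R) : R[i] :=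
  verblunsky mu (tilt_density mu t) n.

(* support of mu, as a subset of the unit circle; mu is a measure on
   theta in (-pi, pi], identified with e^{i theta} *)
Definition supp (mu : {measure set R -> \bar R}) : set R[i] :=
  [set z | forall e : R, 0 < e ->
     (0 < mu [set th | (- pi < th <= pi)%R /\ (Normc.normc (expi th - z) < e)%R])%E].

Definition sigma_ess (mu : {measure set R -> \bar R}) : set R[i] :=
  [set z | supp mu z /\ forall e : R, 0 < e ->
     exists w, [/\ supp mu w, w != z & Normc.normc (w - z) < e]].

Definition Theta (mu : {measure set R -> \bar R}) : R :=
  inf [set `|th| | th in [set th : R | - pi < th <= pi /\ sigma_ess mu (expi th)]].

Definition point_mass (mu : {measure set R -> \bar R}) (z : R[i]) : R :=
  fine (mu [set th | - pi < th <= pi /\ expi th = z]).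

Definition cvgC_pinfty (f : R -> R[i]) (L : R[i]) : Prop :=
  (fun t => Normc.normc (f t - L)) x @[x --> +oo] --> (0 : R).

End OPUC.

(* Main.v *)
(** Fix [j] and put [z k = expi (th k)].  Since [th] lists the part of the
    support inside [|x| < Theta] by increasing modulus, the measure is purely
    atomic on [|x| < |th N|], with positive masses at the [th k].  As [t] grows,
    the tilted weight on the atoms closer to [0] dominates, exponentially, the
    weight on the farther ones and on the tail [|x| >= |th N|].

    Let [P] be the conjectural limit of [Phi_(j+1)]: it vanishes at the [z k]
    with [k < j], and its last root is [z j], or the [beta]-weighted mean of the
    two nodes at distance [|th j|], which makes [P] orthogonal to
    [prod_(k < j) (X - z k)] on these two nodes.  The difference
    [q = Phi_(j+1) - P] has degree at most [j], so orthogonality gives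
    [<q, q> = - <q, P>].  The left side dominates the weighted values
    [|q (z k)|^2], [k <= j]; in the right side only the tail and the values
    [q (z k)], [k < j], survive.  AM-GM then forces [q (z k)] to be
    exponentially small for all [k <= j], and Lagrange interpolation transfers
    this to [q 0], that is, to [alpha_j]. *)

Require Import Defs.
From HB Require Import structures.
From mathcomp Require Import all_boot all_order all_algebra.
From mathcomp Require Import all_classical all_reals all_analysis.
From mathcomp Require Import complex.
From mathcomp Require Import measurable_realfun qpoly ring lra.
Set Implicit Arguments.
Unset Strict Implicit.
Unset Printing Implicit Defensive.
Import Order.TTheory GRing.Theory Num.Theory.
Import numFieldNormedType.Exports.
Local Open Scope classical_set_scope.
Local Open Scope ring_scope.
Local Open Scope complex_scope.

Local Notation normc := Normc.normc.

(** * The modulus on [R[i]] and the unit-circle points [expi x] *)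

Section ComplexNorm.
Variable R : realType.
Implicit Types z : R[i].

Lemma complex_ext z1 z2 : complex.Re z1 = complex.Re z2 ->
  complex.Im z1 = complex.Im z2 -> z1 = z2.
Proof. by case: z1 z2 => ? ? [? ?] /= -> ->. Qed.

Lemma normc_ge0 z : 0 <= normc z.
Proof. by case: z => a b /=; exact: sqrtr_ge0. Qed.

Lemma normc_conj z : normc z^* = normc z.
Proof. by case: z => a b /=; rewrite sqrrN. Qed.

Lemma normc_real (x : R) : normc x%:C = `|x|.
Proof. by rewrite /= expr0n/= addr0 sqrtr_sqr. Qed.

Lemma le_Re_normc z : `|complex.Re z| <= normc z.
Proof.
case: z => a b /=; rewrite -sqrtr_sqr ler_sqrt ?lerDl ?sqr_ge0//.
by rewrite addr_ge0 ?sqr_ge0.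
Qed.

Lemma le_Im_normc z : `|complex.Im z| <= normc z.
Proof.
case: z => a b /=; rewrite -sqrtr_sqr ler_sqrt ?lerDr ?sqr_ge0//.
by rewrite addr_ge0 ?sqr_ge0.
Qed.

Lemma normc_le_ReIm z : normc z <= `|complex.Re z| + `|complex.Im z|.
Proof.
case: z => a b /=.
rewrite -[leRHS]ger0_norm ?addr_ge0// -sqrtr_sqr ler_sqrt ?sqr_ge0//.
by rewrite sqrrD !real_normK ?num_real// lerD2r lerDl mulrn_wge0// mulr_ge0.
Qed.

Lemma le_normc_sum (I : Type) (r : seq I) (P : pred I) (F : I -> R[i]) :
  normc (\sum_(i <- r | P i) F i) <= \sum_(i <- r | P i) normc (F i).
Proof.
elim/big_rec2: _ => [|i y z _ h]; first by rewrite Normc.normc0.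
by rewrite (le_trans (le_normcD _ _))// lerD2l.
Qed.

Lemma normc_prod (I : Type) (r : seq I) (P : pred I) (F : I -> R[i]) :
  normc (\prod_(i <- r | P i) F i) = \prod_(i <- r | P i) normc (F i).
Proof. exact: (big_morph _ (@Normc.normcM R) (@Normc.normc1 R)). Qed.

Lemma mulcJ_normc z : z^* * z = (normc z ^+ 2)%:C.
Proof.
case: z => a b /=; rewrite sqr_sqrtr ?addr_ge0 ?sqr_ge0//; simpc.
by apply/eqP; rewrite eq_complex/= -!expr2 eqxx mulrC addrN eqxx.
Qed.

Lemma expiN (x : R) : expi (- x) = (expi x)^*.
Proof. by rewrite /expi cosN sinN. Qed.

Lemma normc_expi (x : R) : normc (expi x) = 1.
Proof. by rewrite /= cos2Dsin2 sqrtr1. Qed.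

End ComplexNorm.

#[local] Arguments Normc.normc : simpl never.
#[local] Arguments expi : simpl never.

(** * Bounded measurable complex functions *)

Section BoundedMeasurable.
Variable R : realType.
Implicit Types f g : R -> R[i].

(** This class is closed under sums, products and conjugation, and all its members are integrable
    for a probability measure. Every integrability condition below reduces to membership in it. *)
Definition bounded_mfun f :=
  [/\ measurable_fun setT (fun x => complex.Re (f x)),
      measurable_fun setT (fun x => complex.Im (f x)) &
      exists M, forall x, normc (f x) <= M].

Lemma bounded_mfunD f g : bounded_mfun f -> bounded_mfun g ->
  bounded_mfun (fun x => f x + g x).
Proof.
move=> [rf jf [M hM]] [rg ig [N hN]]; split.
- rewrite (_ : (fun x => _) = (fun x => complex.Re (f x) + complex.Re (g x))).
    exact: measurable_funD.
  by apply/funext => x; case: (f x) (g x) => ? ? [].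
- rewrite (_ : (fun x => _) = (fun x => complex.Im (f x) + complex.Im (g x))).
    exact: measurable_funD.
  by apply/funext => x; case: (f x) (g x) => ? ? [].
- exists (M + N) => x; rewrite (le_trans (le_normcD _ _))//.
  exact: lerD.
Qed.

Lemma bounded_mfunM f g : bounded_mfun f -> bounded_mfun g ->
  bounded_mfun (fun x => f x * g x).
Proof.
move=> [rf jf [M hM]] [rg ig [N hN]]; split.
- rewrite (_ : (fun x => _) = (fun x => complex.Re (f x) * complex.Re (g x) -
     complex.Im (f x) * complex.Im (g x))).
    by apply: measurable_funB; exact: measurable_funM.
  by apply/funext => x; case: (f x) (g x) => ? ? [].
- rewrite (_ : (fun x => _) = (fun x => complex.Re (f x) * complex.Im (g x) +
     complex.Im (f x) * complex.Re (g x))).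
    by apply: measurable_funD; exact: measurable_funM.
  by apply/funext => x; case: (f x) (g x) => ? ? [].
- by exists (M * N) => x; rewrite Normc.normcM ler_pM ?normc_ge0.
Qed.

Lemma bounded_mfun_cst c : bounded_mfun (fun=> c).
Proof. by split; [exact: measurable_cst..|exists (normc c)]. Qed.

Lemma bounded_mfun_conj f : bounded_mfun f -> bounded_mfun (fun x => (f x)^*).
Proof.
move=> [rf jf [M hM]]; split.
- by rewrite (_ : (fun x => _) = (fun x => complex.Re (f x)))//;
    apply/funext => x; case: (f x).
- rewrite (_ : (fun x => _) = (fun x => - complex.Im (f x))).
    exact: measurableT_comp.
  by apply/funext => x; case: (f x).
- by exists M => x; rewrite normc_conj.
Qed.

Lemma bounded_mfun_real (f : R -> R) M : measurable_fun setT f ->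
  (forall x, `|f x| <= M) -> bounded_mfun (fun x => (f x)%:C).
Proof.
by move=> mf fM; split=> //; exists M => x; rewrite normc_real.
Qed.

Lemma bounded_mfun_expi : bounded_mfun (@expi R).
Proof.
split; [| |by exists 1 => x; rewrite normc_expi].
- by apply: continuous_measurable_fun; exact: continuous_cos.
- by apply: continuous_measurable_fun; exact: continuous_sin.
Qed.

Lemma bounded_mfun_horner (p : {poly R[i]}) :
  bounded_mfun (fun x => p.[expi x]).
Proof.
elim/poly_ind: p => [|p c IH].
  by under eq_fun do rewrite horner0; exact: bounded_mfun_cst.
under eq_fun do rewrite !hornerE.
apply: bounded_mfunD; last exact: bounded_mfun_cst.
exact: bounded_mfunM IH bounded_mfun_expi.
Qed.

End BoundedMeasurable.

(** * Linearity and bounds for the complex integral *)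

Section ComplexIntegral.
Variables (R : realType) (mu : probability R R).
Implicit Types f g : R -> R[i].

Lemma bounded_integrable (f : R -> R) M : measurable_fun setT f ->
  (forall x, `|f x| <= M) -> mu.-integrable setT (EFin \o f).
Proof.
move=> mf fM; apply: measurable_bounded_integrable => //.
  by rewrite (@le_lt_trans _ _ 1%E) ?ltry// probability_le1.
by exists M; split; rewrite ?num_real // => x Mx y _ /=; exact: le_trans (ltW Mx).
Qed.

Lemma integrable_Re f : bounded_mfun f ->
  mu.-integrable setT (EFin \o (fun x => complex.Re (f x))).
Proof.
move=> [rf _ [M hM]]; apply: (@bounded_integrable _ M) => // x.
exact: le_trans (le_Re_normc _) _.
Qed.

Lemma integrable_Im f : bounded_mfun f ->
  mu.-integrable setT (EFin \o (fun x => complex.Im (f x))).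
Proof.
move=> [_ jf [M hM]]; apply: (@bounded_integrable _ M) => // x.
exact: le_trans (le_Im_normc _) _.
Qed.

Lemma CintegralD f g : bounded_mfun f -> bounded_mfun g ->
  Cintegral mu (fun x => f x + g x) = Cintegral mu f + Cintegral mu g.
Proof.
move=> bf bg; apply: complex_ext => /=.
- rewrite -RintegralD//; [|exact: integrable_Re..].
  by apply: eq_Rintegral => x _; case: (f x) (g x) => ? ? [].
- rewrite -RintegralD//; [|exact: integrable_Im..].
  by apply: eq_Rintegral => x _; case: (f x) (g x) => ? ? [].
Qed.

Lemma CintegralZ c f : bounded_mfun f ->
  Cintegral mu (fun x => c * f x) = c * Cintegral mu f.
Proof.
case: c => a b bf.
have iR := integrable_Re bf; have iI := integrable_Im bf.
apply: complex_ext => /=.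
- rewrite -!RintegralZl// -RintegralB//.
  + by apply: eq_Rintegral => x _; case: (f x).
  + exact: (integrableZl _ _ iR).
  + exact: (integrableZl _ _ iI).
- rewrite -!RintegralZl// -RintegralD//.
  + by apply: eq_Rintegral => x _; case: (f x).
  + exact: (integrableZl _ _ iI).
  + exact: (integrableZl _ _ iR).
Qed.

Lemma Cintegral_sum (I : Type) (r : seq I) (F : I -> R -> R[i]) :
  (forall i, bounded_mfun (F i)) ->
  Cintegral mu (fun x => \sum_(i <- r) F i x) = \sum_(i <- r) Cintegral mu (F i).
Proof.
move=> bF.
have bS s : bounded_mfun (fun x => \sum_(i <- s) F i x).
  elim: s => [|i s IH]; first by under eq_fun do rewrite big_nil; exact: bounded_mfun_cst.
  by under eq_fun do rewrite big_cons; exact: bounded_mfunD.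
elim: r => [|i r IH].
  rewrite big_nil /Cintegral.
  by under eq_Rintegral do rewrite big_nil; rewrite Rintegral_cst//= mul0r;
     under eq_Rintegral do rewrite big_nil; rewrite Rintegral_cst//= mul0r.
by under [in LHS]eq_fun do rewrite big_cons; rewrite CintegralD// IH big_cons.
Qed.

Lemma Cintegral_real (f : R -> R) :
  Cintegral mu (fun x => (f x)%:C) = (Rintegral mu setT f)%:C.
Proof. by rewrite /Cintegral/= Rintegral_cst// mul0r. Qed.

Lemma normr_Rintegral_le (f : R -> R) M : measurable_fun setT f ->
  (forall x, `|f x| <= M) -> `|Rintegral mu setT f| <= M.
Proof.
move=> mf fM; have iF := bounded_integrable mf fM.
rewrite (le_trans (le_normr_Rintegral _ _))//.
have -> : M = Rintegral mu setT (fun=> M).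
  by rewrite Rintegral_cst//= [mu _]probability_setT/= mulr1.
apply: le_Rintegral => //.
- by apply: (@bounded_integrable _ M) => [|x]; [exact: measurableT_comp|rewrite normr_id].
- by apply: (@bounded_integrable _ `|M|) => //; exact: measurable_cst.
Qed.

(** The factor 2 comes from bounding the real and imaginary parts separately; the later estimates
    need only some constant. *)
Lemma normc_Cintegral_le f M : bounded_mfun f -> (forall x, normc (f x) <= M) ->
  normc (Cintegral mu f) <= M *+ 2.
Proof.
move=> [rf jf _] fM; rewrite (le_trans (normc_le_ReIm _))//= mulr2n lerD//.
- by apply: normr_Rintegral_le => // x; exact: le_trans (le_Re_normc _) _.
- by apply: normr_Rintegral_le => // x; exact: le_trans (le_Im_normc _) _.
Qed.

End ComplexIntegral.

(** * The angular parametrization of the circle by [(-pi, pi]] *)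

Section Circle.
Variable R : realType.
Implicit Types x y e : R.

Lemma norm_le_pi x : - pi < x <= pi -> `|x| <= pi.
Proof. by move=> /andP[x1 x2]; rewrite ler_norml x2 ltW. Qed.

Lemma cos_lt_norm x y : `|x| <= pi -> `|y| <= pi ->
  (cos x < cos y) = (`|y| < `|x|).
Proof.
by move=> xpi ypi; rewrite -(cos_norm x) -(cos_norm y) ltr_cos// in_itv/= normr_ge0.
Qed.

Lemma cos_le_norm x y : `|x| <= pi -> `|y| <= pi ->
  (cos x <= cos y) = (`|y| <= `|x|).
Proof. by move=> xpi ypi; rewrite !leNgt cos_lt_norm. Qed.

(** Equal cosines give equal absolute values. If [x = - y], equal sines force [sin y = 0]; since
    both [y] and [- y] exceed [- pi], only [y = 0] is left. *)
Lemma expi_inj x y : - pi < x <= pi -> - pi < y <= pi ->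
  expi x = expi y -> x = y.
Proof.
move=> xpi ypi [cxy sxy].
have [xpi' ypi'] := (norm_le_pi xpi, norm_le_pi ypi).
have /eqP : `|x| = `|y|.
  by apply/eqP; rewrite eq_le -!cos_le_norm// cxy lexx.
rewrite eqr_norm2 => /orP[/eqP//|/eqP xNy].
have sy0 : sin y = 0 by move: sxy; rewrite xNy sinN; lra.
have [y0|y0|y0] := ltgtP y 0; last 1 first.
- by rewrite xNy y0 oppr0.
- have : 0 < sin (- y) by apply: sin_gt0_pi; move: xpi ypi; lra.
  by rewrite sinN sy0 oppr0 ltxx.
- have : 0 < sin y by apply: sin_gt0_pi; move: xpi ypi; lra.
  by rewrite sy0 ltxx.
Qed.

Lemma expi_continuous x e : 0 < e ->
  exists2 d, 0 < d & forall y, `|x - y| < d -> normc (expi y - expi x) < e.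
Proof.
move=> e0.
have e20 : 0 < e / 2 by rewrite divr_gt0.
have /cvgrPdist_lt /(_ _ e20) [d1 /= d10 h1] := @continuous_cos R x.
have /cvgrPdist_lt /(_ _ e20) [d2 /= d20 h2] := @continuous_sin R x.
exists (Num.min d1 d2) => [|y]; first by rewrite lt_min d10.
rewrite lt_min => /andP[/h1 yd1 /h2 yd2].
apply: le_lt_trans (normc_le_ReIm _) _ => /=; rewrite [ltRHS]splitr.
by rewrite ltrD// distrC.
Qed.

Lemma measurable_arc (z : R[i]) e : 0 < e ->
  measurable [set y : R | - pi < y <= pi /\ normc (expi y - z) < e].
Proof.
move=> e0.
rewrite (_ : mkset _ = `]- pi, pi]%classic `&`
   ((fun y => (cos y - complex.Re z) ^+ 2 + (sin y - complex.Im z) ^+ 2) @^-1`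
    `]-oo, (e ^+ 2)[%classic)).
  apply: measurableI; first exact: measurable_itv.
  have mcos : measurable_fun setT (@cos R).
    by apply: continuous_measurable_fun; exact: continuous_cos.
  have msin : measurable_fun setT (@sin R).
    by apply: continuous_measurable_fun; exact: continuous_sin.
  have mf : measurable_fun setT (fun y : R =>
      (cos y - complex.Re z) ^+ 2 + (sin y - complex.Im z) ^+ 2).
    by apply: measurable_funD; apply: measurable_funX; apply: measurable_funB.
  by rewrite -[X in measurable X]setTI; apply: mf => //; exact: measurable_itv.
apply/seteqP; split => y /=; rewrite !in_itv/=; case: z => a b; rewrite /Normc.normc /=.
- move=> [-> h]; split => //; rewrite -(@sqr_sqrtr _ (_ + _)) ?addr_ge0 ?sqr_ge0//.
  by rewrite ltr_pXn2r// nnegrE ?sqrtr_ge0 ?ltW.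
- move=> [-> h]; split => //.
  by rewrite -[ltRHS](@ger0_norm _ e) ?ltW// -sqrtr_sqr ltr_sqrt// exprn_gt0.
Qed.

Lemma exists_lower_bound n (F : nat -> R) : (forall i, (i < n)%N -> 0 < F i) ->
  exists2 e, 0 < e & forall i, (i < n)%N -> e <= F i.
Proof.
elim: n => [_|n IH Fgt0]; first by exists 1.
have [|e e0 eF] := IH; first by move=> i lin; apply: Fgt0; exact: leqW.
exists (Num.min e (F n)) => [|i]; first by rewrite lt_min e0 Fgt0.
rewrite ltnS leq_eqVlt => /orP[/eqP ->|/eF h]; first by rewrite ge_min lexx orbT.
by rewrite ge_min h.
Qed.

End Circle.

(** * Null sets: the complement of the support and of [(-pi, pi]] *)

Section NegligibleSets.
Variables (R : realType) (mu : probability R R).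

Lemma Cintegral_ae (f g : R -> R[i]) : bounded_mfun f -> bounded_mfun g ->
  mu.-negligible [set x | f x <> g x] -> Cintegral mu f = Cintegral mu g.
Proof.
move=> [rf jf _] [rg ig _] fg; rewrite /Cintegral /Rintegral.
congr (fine _ +i* fine _); apply: ae_eq_integral => //;
  try (by apply/measurable_EFinP);
  by apply: negligibleS fg => x /= /not_implyP[_] h; apply: contra_not h => ->.
Qed.

(* Rational intervals form a countable base, so the complement of the support
   is a countable union of null intervals. *)
Lemma negligible_off_supp :
  mu.-negligible [set x : R | - pi < x <= pi /\ ~ supp mu (expi x)].
Proof.
pose J (ab : rat * rat) : set R := `]ratr ab.1, ratr ab.2[%classic `&` `]- pi, pi]%classic.
have mJ ab : measurable (J ab) by apply: measurableI; exact: measurable_itv.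
pose F n := if unpickle n is Some ab then
  if mu (J ab) == 0%E then J ab else set0 else set0.
apply: (@negligibleS _ _ _ _ (\bigcup_n F n)); last first.
  apply: negligible_bigcup => n; rewrite /F.
  case: unpickle => [ab|]; last exact: negligible_set0.
  by case: ifPn => [/eqP ?|_]; [apply/negligibleP|exact: negligible_set0].
move=> x /= [xpi /existsNP[e /not_implyP[e0 /negP]]].
rewrite lt0e measure_ge0 andbT negbK => /eqP mu0.
have [d d0 hd] := expi_continuous x e0.
have [|a] := @rat_in_itvoo R (x - d) x; first by lra.
have [|b] := @rat_in_itvoo R x (x + d); first by lra.
rewrite !in_itv/= => /andP[b1 b2] /andP[a1 a2].
exists (pickle (a, b)); [exact: I|rewrite /F pickleK].
have -> : mu (J (a, b)) == 0%E.
  rewrite -measure_le0 -mu0 le_measure ?inE//; first exact: measurable_arc.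
  move=> y [/=]; rewrite !in_itv/= => /andP[y1 y2] ypi; split => //.
  by apply: hd; rewrite ltr_norml; lra.
by split; rewrite /= in_itv/= ?a2 ?b1.
Qed.

Hypothesis mu1 : mu (`]- pi, pi]%classic : set R) = 1%E.

Lemma negligible_outside_pi : mu.-negligible (~` (`]- pi, pi]%classic : set R)).
Proof.
apply/negligibleP; first by apply: measurableC; exact: measurable_itv.
have mI : measurable (`]- pi, pi]%classic : set R) by exact: measurable_itv.
by rewrite [LHS](probability_setC mu mI) mu1 subee.
Qed.

End NegligibleSets.

(** * Atomic structure of the measure inside [|x| < Theta] *)

Section Atoms.
Variables (R : realType) (mu : probability R R) (th : nat -> R).
Hypothesis mu1 : mu (`]- pi, pi]%classic : set R) = 1%E.
Hypothesis th_inj : injective th.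
Hypothesis th_range : range th =
  [set x : R | [/\ - pi < x <= pi, `|x| < Theta mu & supp mu (expi x)]].
Hypothesis th_nondec : forall k, `|th k| <= `|th k.+1|.

Lemma th_pi k : - pi < th k <= pi.
Proof.
have : range th (th k) by exists k.
by rewrite th_range => -[].
Qed.

Lemma norm_th_le_pi k : `|th k| <= pi.
Proof. exact: norm_le_pi (th_pi k). Qed.

Lemma expi_th_inj : injective (fun k => expi (th k)).
Proof. by move=> i k /(expi_inj (th_pi i) (th_pi k)) /th_inj. Qed.

Lemma norm_th_homo i k : (i <= k)%N -> `|th i| <= `|th k|.
Proof. by apply: (@homo_leq _ (fun k => `|th k|) Order.le) => //; exact: le_trans. Qed.

Lemma norm_th_eq i k : i != k -> `|th i| = `|th k| -> th i = - th k.
Proof.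
move=> ik /eqP; rewrite eqr_norm2 => /orP[/eqP/th_inj/eqP|/eqP//].
by rewrite (negPf ik).
Qed.

(** Only the two reals [x] and [- x] share a modulus, so by injectivity three consecutive [th]
    cannot all have the same one. *)
Lemma norm_thSS k : `|th k| < `|th k.+2|.
Proof.
rewrite lt_neqAle norm_th_homo ?andbT; last by rewrite ltnW.
apply/eqP => h.
have h1 : `|th k| = `|th k.+1|.
  by apply/eqP; rewrite eq_le th_nondec h th_nondec.
have e1 := norm_th_eq (negbT (ltn_eqF (ltnSn k))) h1.
have e2 : th k = - th k.+2.
  by apply: norm_th_eq => //; rewrite ltn_eqF// ltnW.
have /th_inj/eqP : th k.+1 = th k.+2 by apply: oppr_inj; rewrite -e1.
by rewrite ltn_eqF.
Qed.

Definition tail_set n := [set x : R | - pi < x <= pi /\ `|th n| <= `|x|].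

Lemma measurable_tail_set n : measurable (tail_set n).
Proof.
rewrite (_ : tail_set n = `]- pi, pi]%classic `&` (@Num.norm _ R) @^-1` `[`|th n|, +oo[%classic).
  apply: measurableI; first exact: measurable_itv.
  rewrite -[X in measurable X]setTI; apply: (normr_measurable measurableT).
  exact: measurable_itv.
by apply/seteqP; split => x /=; rewrite !in_itv/= andbT.
Qed.

(** Up to null sets [x] is a support point in [(-pi, pi]]. Outside the tail it satisfies
    [|x| < |th n| < Theta], so it is some [th i], and monotonicity of the moduli gives [i < n]. *)
Lemma negligible_gap n :
  mu.-negligible [set x : R | ~ tail_set n x /\ forall i, (i < n)%N -> x <> th i].
Proof.
apply: (@negligibleS _ _ _ _ (~` (`]- pi, pi]%classic : set R) `|`
   [set x : R | - pi < x <= pi /\ ~ supp mu (expi x)])).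
  move=> x /= [nx xth]; rewrite in_itv/=.
  have [xpi|] := boolP (- pi < x <= pi); last by left; exact/negP.
  right; split => // sx.
  have xn : `|x| < `|th n| by rewrite ltNge; apply/negP => h; apply: nx.
  have : range th x.
    have : range th (th n) by exists n.
    rewrite th_range => -[_ nT _]; split => //; exact: lt_trans xn nT.
  move=> [i _ ix]; apply: (xth i) => //; rewrite ltnNge; apply/negP => /norm_th_homo.
  by rewrite leNgt ix xn.
by apply: negligibleU; [exact: negligible_outside_pi|exact: negligible_off_supp].
Qed.

Definition mass k := fine (mu [set th k]).

Lemma mass_fin k : (mass k)%:E = mu [set th k].
Proof. by rewrite fineK// fin_num_measure. Qed.

(** A short arc around [expi (th k)] meets neither the other nodes of index below [k.+2] nor the
    tail at [k.+2]. If [th k] had no mass, [negligible_gap] would make this arc null, against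
    membership in the support. *)
Lemma mass_gt0 k : 0 < mass k.
Proof.
rewrite -lte_fin mass_fin lt0e measure_ge0 andbT; apply/eqP => mk0.
(* [F i] is the distance to the node [i]. The free slot [i = k] holds a lower bound for the distance
   to the tail; the tail starts at [k.+2] because [th k.+1] may have the same modulus as [th k]. *)
pose F i := if i == k then cos (th k) - cos (th k.+2)
            else normc (expi (th i) - expi (th k)).
have [|e e0 eF] := @exists_lower_bound R k.+2 F.
  move=> i _; rewrite /F; case: eqVneq => [_|ik].
    by rewrite subr_gt0 cos_lt_norm ?norm_th_le_pi ?norm_thSS.
  rewrite lt_neqAle normc_ge0 andbT eq_sym; apply/eqP => /Normc.eq0_normc/eqP.
  by rewrite subr_eq0 => /eqP/expi_th_inj/eqP; rewrite (negPf ik).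
have : range th (th k) by exists k.
rewrite th_range => -[_ _ /(_ e e0)]; rewrite lt0e => /andP[/negP + _]; apply.
apply/eqP/negligibleP; first exact: measurable_arc.
apply: (@negligibleS _ _ _ _ ([set th k] `|`
   [set x : R | ~ tail_set k.+2 x /\ forall i, (i < k.+2)%N -> x <> th i])); last first.
  by apply: negligibleU; [exact/negligibleP|exact: negligible_gap].
move=> y /= [ypi ye]; have [->|yk] := eqVneq y (th k); [by left|right].
split=> [[_ ny]|i ik yi].
  move: ye; apply/negP; rewrite -leNgt (le_trans (eF k _))// /F eqxx.
  apply: le_trans (le_Re_normc _); rewrite /= distrC; apply: le_trans (ler_norm _).
  by rewrite lerB// cos_le_norm// ?norm_th_le_pi// norm_le_pi.
move: ye; apply/negP; rewrite -leNgt (le_trans (eF i _))// /F yi.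
by case: eqP yi => [-> yi|//]; move: yk; rewrite yi eqxx.
Qed.

Lemma point_mass_th k : point_mass mu (expi (th k)) = mass k.
Proof.
rewrite /point_mass /mass; congr (fine (mu _)); apply/seteqP; split => x /=.
  by move=> [xpi /(expi_inj xpi (th_pi k))].
by move=> ->; split => //; exact: th_pi.
Qed.

(** The strict jump of modulus at [n] keeps the atoms [th i], [i < n], out of the tail, so that no
    atom is counted twice; the rest is null by [negligible_gap]. *)
Lemma Cintegral_atoms n (f : R -> R[i]) :
  (forall i, (i < n)%N -> `|th i| < `|th n|) -> bounded_mfun f ->
  Cintegral mu f = \sum_(i < n) (mass i)%:C * f (th i) +
    Cintegral mu (fun x => (\1_(tail_set n) x)%:C * f x).
Proof.
move=> lin bf.
have b1 A : measurable A -> bounded_mfun (fun x : R => (\1_A x)%:C).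
  move=> mA; apply: (@bounded_mfun_real _ _ 1) => [|x]; first exact: measurable_indic.
  by rewrite indicE; case: (_ \in _); rewrite ?normr1 ?normr0.
pose g i x := f (th i) * (\1_[set th i] x)%:C : R[i].
have bg i : bounded_mfun (g i).
  by apply: bounded_mfunM; [exact: bounded_mfun_cst|exact: b1].
have bB : bounded_mfun (fun x => (\1_(tail_set n) x)%:C * f x).
  by apply: bounded_mfunM bf; apply: b1; exact: measurable_tail_set.
have bS : bounded_mfun (fun x => \sum_(i < n) g i x).
  elim: (index_enum _) => [|i s IH].
    by under eq_fun do rewrite big_nil; exact: bounded_mfun_cst.
  by under eq_fun do rewrite big_cons; exact: bounded_mfunD.
transitivity (Cintegral mu (fun x => \sum_(i < n) g i x + (\1_(tail_set n) x)%:C * f x)).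
  apply: Cintegral_ae => //; first exact: bounded_mfunD.
  apply: negligibleS (negligible_gap n) => x /= fx; split.
    move=> Bx; apply: fx; rewrite big1 ?add0r => [|i _].
      by rewrite indicE mem_set// mul1r.
    rewrite /g indicE memNset ?mulr0//= => xi; case: Bx => _.
    by rewrite xi leNgt lin.
  move=> i ltin xi; apply: fx; rewrite (bigD1 (Ordinal ltin))//= big1 => [|k ki].
    rewrite /g xi !indicE mem_set//= memNset ?mul0r ?addr0 ?mulr1//.
    by move=> [_]; rewrite leNgt lin.
  rewrite /g indicE memNset ?mulr0//= xi => /th_inj ik; move/eqP: ki; apply.
  exact/val_inj.
rewrite CintegralD// Cintegral_sum//; congr (_ + _); apply: eq_bigr => i _.
rewrite CintegralZ; last exact: b1.
by rewrite Cintegral_real /Rintegral integral_indic// setIT mulrC.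
Qed.

End Atoms.

(** * Bounding a polynomial by its values at the nodes *)

Section LagrangeBound.
Variables (R : realType) (z : nat -> R[i]).
Hypothesis z_inj : injective z.

Lemma poly_eq0_nodes n (p : {poly R[i]}) : (size p <= n.+1)%N ->
  (forall i, (i < n.+1)%N -> p.[z i] = 0) -> p = 0.
Proof.
move=> sp p0; rewrite (@lagrange_gen _ n.+1 z isT z_inj p sp).
by apply: big1 => i _; rewrite p0 ?polyC0 ?mul0r.
Qed.

(** Expand [p] in the Lagrange basis at the nodes and bound each basis polynomial along [F]. Leaving
    [F] free covers both the whole circle and the single point [0]. *)
Lemma lagrange_bound (T : Type) (F : T -> R[i]) n :
  (forall p : {poly R[i]}, exists M : R, forall x, normc p.[F x] <= M) ->
  exists2 C : R, 0 <= C & forall (p : {poly R[i]}) x, (size p <= n.+1)%N ->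
    normc p.[F x] <= C * \sum_(i < n.+1) normc p.[z i].
Proof.
move=> bF.
pose L (i : 'I_n.+1) : {poly R[i]} := tnth (lagrange n.+1 z) i.
pose M i := projT1 (cid (bF (L i))).
have hM i x : normc (L i).[F x] <= M i by exact: projT2 (cid (bF (L i))) x.
exists (\sum_i `|M i|); first by rewrite sumr_ge0.
move=> p x sp.
rewrite {1}(@lagrange_gen _ n.+1 z isT z_inj p sp) horner_sum.
rewrite (le_trans (le_normc_sum _ _ _))// mulr_sumr ler_sum// => i _.
rewrite hornerM hornerC Normc.normcM mulrC ler_wpM2r ?normc_ge0//.
rewrite (le_trans (hM i x))// (bigD1 i)//= (le_trans (ler_norm _))// lerDl.
by rewrite sumr_ge0.
Qed.

End LagrangeBound.

(** * The weighted Hermitian form and existence of the orthogonal polynomials *)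

Section HermitianForm.
Variables (R : realType) (mu : probability R R) (w : R -> R).
Hypothesis bw : bounded_mfun (fun x => (w x)%:C).
Hypothesis w_gt0 : forall x, 0 < w x.
Implicit Types a b : {poly R[i]}.

(** The inner product of [L^2(w dmu)] on polynomials, conjugate-linear in the first argument. *)
Definition hform a b :=
  Cintegral mu (fun x => (w x)%:C * (a.[expi x])^* * b.[expi x]).

Lemma bounded_hform a b :
  bounded_mfun (fun x => (w x)%:C * (a.[expi x])^* * b.[expi x]).
Proof.
apply: bounded_mfunM; last exact: bounded_mfun_horner.
by apply: bounded_mfunM bw _; apply: bounded_mfun_conj; exact: bounded_mfun_horner.
Qed.

Lemma hformB a b1 b2 : hform a (b1 - b2) = hform a b1 - hform a b2.
Proof.
have -> : hform a b1 - hform a b2 = hform a b1 + (-1) * hform a b2 by ring.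
rewrite /hform -CintegralZ; last exact: bounded_hform.
rewrite -CintegralD; last 2 first.
- exact: bounded_hform.
- by apply: bounded_mfunM (bounded_hform _ _); exact: bounded_mfun_cst.
by congr Cintegral; apply/funext => x; rewrite hornerD hornerN; ring.
Qed.

Lemma hform_suml n (c : nat -> R[i]) (F : nat -> {poly R[i]}) b :
  hform (\sum_(i < n) c i *: F i) b = \sum_(i < n) (c i)^* * hform (F i) b.
Proof.
rewrite /hform; under [RHS]eq_bigr => i _ do rewrite -(CintegralZ _ _ (bounded_hform _ _)).
rewrite -Cintegral_sum; last first.
  by move=> i; apply: bounded_mfunM (bounded_hform _ _); exact: bounded_mfun_cst.
congr Cintegral; apply/funext => x; rewrite horner_sum rmorph_sum mulr_sumr mulr_suml.
by apply: eq_bigr => i _; rewrite hornerZ rmorphM/=; ring.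
Qed.

Lemma hform_sumr n (c : nat -> R[i]) (F : nat -> {poly R[i]}) a :
  hform a (\sum_(i < n) c i *: F i) = \sum_(i < n) c i * hform a (F i).
Proof.
rewrite /hform; under [RHS]eq_bigr => i _ do rewrite -(CintegralZ _ _ (bounded_hform _ _)).
rewrite -Cintegral_sum; last first.
  by move=> i; apply: bounded_mfunM (bounded_hform _ _); exact: bounded_mfun_cst.
congr Cintegral; apply/funext => x; rewrite horner_sum mulr_sumr.
by apply: eq_bigr => i _; rewrite hornerZ; ring.
Qed.

Lemma poly_sumX n a : (size a <= n)%N -> a = \sum_(i < n) a`_i *: 'X^i.
Proof.
move=> sa; rewrite -poly_def; apply/polyP => i; rewrite coef_poly.
by case: ltnP => // ni; rewrite nth_default// (leq_trans sa).
Qed.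

Lemma monic_orth_hform n p a : monic_orth mu w n p -> (size a <= n)%N ->
  hform a p = 0.
Proof.
move=> [_ _ op] sa; rewrite (poly_sumX sa) (hform_suml _ (fun i => a`_i) (fun i => 'X^i)).
rewrite big1// => i _; rewrite [X in _ * X](_ : _ = 0) ?mulr0//.
rewrite -(op i (ltn_ord i)) /hform; congr Cintegral; apply/funext => x.
by rewrite hornerXn.
Qed.

Section Existence.
Variable th : nat -> R.
Hypothesis mu1 : mu (`]- pi, pi]%classic : set R) = 1%E.
Hypothesis th_inj : injective th.
Hypothesis th_range : range th =
  [set x : R | [/\ - pi < x <= pi, `|x| < Theta mu & supp mu (expi x)]].
Hypothesis th_nondec : forall k, `|th k| <= `|th k.+1|.

Lemma hform_atoms n a b : (forall i, (i < n)%N -> `|th i| < `|th n|) ->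
  hform a b =
    \sum_(i < n) (mass mu th i)%:C *
      ((w (th i))%:C * (a.[expi (th i)])^* * b.[expi (th i)]) +
    Cintegral mu (fun x => (\1_(tail_set th n) x)%:C *
      ((w x)%:C * (a.[expi x])^* * b.[expi x])).
Proof.
move=> lin; rewrite /hform (Cintegral_atoms mu1 th_inj th_range th_nondec lin)//.
exact: bounded_hform.
Qed.

(** On the diagonal the integrand is [w * |a|^2 >= 0], so discarding the tail can only decrease the
    integral. *)
Lemma hform_ge_atoms n a : (forall i, (i < n)%N -> `|th i| < `|th n|) ->
  \sum_(i < n) mass mu th i * w (th i) * normc a.[expi (th i)] ^+ 2
    <= complex.Re (hform a a).
Proof.
move=> lin; rewrite (hform_atoms _ _ lin).
have E x : (w x)%:C * (a.[expi x])^* * a.[expi x] = (w x * normc a.[expi x] ^+ 2)%:C.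
  by rewrite -mulrA mulcJ_normc -rmorphM.
under [X in complex.Re (X + _)]eq_bigr do rewrite E -rmorphM/= mulrA.
rewrite -rmorph_sum.
under [X in _ + Cintegral mu X]eq_fun do rewrite E -rmorphM/=.
rewrite Cintegral_real -rmorphD/= lerDl Rintegral_ge0// => x _.
by rewrite mulr_ge0// mulr_ge0 ?sqr_ge0 ?ltW.
Qed.

(** Splitting off the atoms requires a strict jump of modulus; by [norm_thSS] one occurs at [k.+1]
    or at [k.+2]. *)
Lemma exists_strict_index k :
  exists2 n, (k < n)%N & forall i, (i < n)%N -> `|th i| < `|th n|.
Proof.
have H := norm_th_homo th_nondec.
have [kS|kS] := ltP `|th k| `|th k.+1|.
  by exists k.+1 => // i; rewrite ltnS => /H /le_lt_trans; apply.
exists k.+2 => // i; rewrite ltnS => /H /le_lt_trans; apply.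
by rewrite (le_lt_trans kS)// norm_thSS.
Qed.

Lemma hform_eq0 a : hform a a = 0 -> forall k, a.[expi (th k)] = 0.
Proof.
move=> a0 k; have [n kn lin] := exists_strict_index k.
have := hform_ge_atoms a lin; rewrite a0/= (bigD1 (Ordinal kn))//= => h.
have mk := mass_gt0 mu1 th_inj th_range th_nondec.
apply: Normc.eq0_normc; apply/eqP; rewrite -sqrf_eq0 eq_le sqr_ge0 andbT.
rewrite -(@pmulr_rle0 _ (mass mu th k * w (th k))) ?mulr_gt0//.
apply: le_trans h; rewrite lerDl sumr_ge0// => i _.
by rewrite mulr_ge0 ?sqr_ge0// mulr_ge0 ?ltW.
Qed.

(** This excludes the default value [0] in [Phi]. A kernel vector of the Gram matrix [G] gives a
    polynomial of degree below [n] and of norm zero; it vanishes at all nodes, hence is zero. So [G]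
    is invertible and the projection of ['X^n] onto lower degrees can be solved for. *)
Lemma monic_orth_exists n : exists p, monic_orth mu w n p.
Proof.
pose G : 'M[R[i]]_n := \matrix_(k, l) hform 'X^k 'X^l.
have uG : G \in unitmx.
  rewrite -row_free_unit; apply: inj_row_free => v vG.
  (* The conjugates compensate for the conjugate-linearity of [hform] in its first argument; [0] is
     a default for [k >= n]. *)
  pose c k := if insub k is Some i then ((v 0 i)^*)%R else 0.
  have cE (i : 'I_n) : c i = ((v 0 i)^*)%R by rewrite /c valK.
  pose a := \sum_(i < n) c i *: 'X^i : {poly R[i]}.
  have aX (l : 'I_n) : hform a 'X^l = 0.
    rewrite /a (hform_suml _ _ (fun i => 'X^i)).
    transitivity ((v *m G) 0 l); last by rewrite vG mxE.
    by rewrite mxE; apply: eq_bigr => i _; rewrite cE conjCK mxE.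
  have sa : (size a <= n)%N by rewrite /a -poly_def size_poly.
  have a0 : hform a a = 0.
    rewrite {2}/a (hform_sumr _ _ (fun i => 'X^i)) big1// => i _.
    by rewrite aX mulr0.
  have /polyP a_eq0 : a = 0.
    apply: (poly_eq0_nodes (expi_th_inj th_inj th_range) (leqW sa)) => i _.
    exact: hform_eq0.
  apply/rowP => i; rewrite mxE; have := a_eq0 i.
  rewrite /a -poly_def coef_poly ltn_ord cE coef0 => h.
  by apply/eqP; rewrite -conjC_eq0 h.
(* Normal equations: [cv] collects the coefficients of the projection [r] of ['X^n]. *)
pose bv : 'cV[R[i]]_n := \col_k hform 'X^k 'X^n.
pose cv := invmx G *m bv.
pose c k := if insub k is Some i then cv i 0 else 0.
have cE (i : 'I_n) : c i = cv i 0 by rewrite /c valK.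
pose r := \sum_(i < n) c i *: 'X^i : {poly R[i]}.
have sr : (size r < size ('X^n : {poly R[i]}))%N.
  by rewrite size_polyXn ltnS /r -poly_def size_poly.
have sNr : (size (- r) < size ('X^n : {poly R[i]}))%N by rewrite size_polyN.
exists ('X^n - r); split.
- by rewrite size_polyDl// size_polyXn.
- by rewrite monicE lead_coefDl// lead_coefXn.
- move=> k kn.
  transitivity (hform 'X^k ('X^n - r)).
    by rewrite /hform; congr Cintegral; apply/funext => x; rewrite hornerXn.
  rewrite hformB {1}/r (hform_sumr _ _ (fun i => 'X^i)).
  have -> : hform 'X^k 'X^n = (G *m cv) (Ordinal kn) 0.
    by rewrite mulmxA mulmxV// mul1mx mxE.
  apply/eqP; rewrite mxE subr_eq0; apply/eqP; apply: eq_bigr => i _.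
  by rewrite cE mxE mulrC.
Qed.

Lemma monic_orth_Phi n : monic_orth mu w n (Phi mu w n).
Proof. by rewrite /Phi; apply: xgetPex; exact: monic_orth_exists. Qed.

End Existence.
End HermitianForm.

(** * The absorption argument for the nodal values *)

Section QuadraticEstimate.
Variable R : realType.

(* AM-GM: [2 m w (c D d) x <= (m w x)^2 + (c D d)^2], and [c d^2 <= w e^2]. *)
Lemma amgm_weight (m w x c D d e : R) : 0 < m -> 0 < w -> 0 <= c ->
  c * d ^+ 2 <= w * e ^+ 2 ->
  c * D * d * x <= m * w * x ^+ 2 / 2 + c * D ^+ 2 * e ^+ 2 / (2 * m).
Proof.
move=> m0 w0 c0 cdwe.
rewrite -subr_ge0 -(@pmulr_rge0 _ (2 * m * w)) ?mulr_gt0//.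
have -> : 2 * m * w * (m * w * x ^+ 2 / 2 + c * D ^+ 2 * e ^+ 2 / (2 * m) - c * D * d * x) =
  (m * w * x - c * D * d) ^+ 2 + c * D ^+ 2 * (w * e ^+ 2 - c * d ^+ 2).
  by field; rewrite gt_eqF.
rewrite addr_ge0 ?sqr_ge0// mulr_ge0 ?subr_ge0//.
by rewrite mulr_ge0// sqr_ge0.
Qed.

(** Meant for [x i = |q (z i)|], with [c] the weight at the level of [th j] and [e ^+ 2] a bound on
    weight ratios. Termwise [amgm_weight] lets half of the left side absorb the [x i] on the right.
    What remains is of order [c * e ^+ 2], while each left term is at least [m * c * x i ^+ 2];
    hence [x i = O(e)]. *)
Lemma quadratic_estimate j (m c C e : R) (x w : nat -> R) :
  0 < m -> 0 < c -> 0 <= C -> 0 < e <= 1 -> (forall i, 0 <= x i) ->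
  (forall i, (i < j)%N -> c <= w i * e ^+ 2) -> w j = c ->
  \sum_(i < j.+1) m * w i * x i ^+ 2 <=
    c * (C * (\sum_(i < j) x i + e ^+ 2 * \sum_(i < j.+1) x i)) ->
  forall i, (i < j.+1)%N -> x i <= j.+1%:R * (C *+ 2) / m * e.
Proof.
move=> m0 c0 C0 /andP[e0 e1] x0 cw wj H i0 i0j.
have e20 : 0 < e ^+ 2 by rewrite exprn_gt0.
have e21 : e ^+ 2 <= 1 by rewrite expr_le1// ltW.
(* Up to a factor 2, [d i] bounds the coefficient of [x i] on the right: [1 + e ^+ 2] below [j], and
   [e ^+ 2] at [j]. *)
pose d i : R := if (i < j)%N then 1 else e ^+ 2.
have cw' i : (i < j.+1)%N -> c <= w i.
  rewrite ltnS leq_eqVlt => /orP[/eqP->|ij]; first by rewrite wj.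
  apply: le_trans (cw i ij) _; rewrite ler_piMr//.
  by rewrite -(pmulr_lge0 _ e20) (le_trans (ltW c0))// cw.
have wgt0 i : (i < j.+1)%N -> 0 < w i by move=> /cw'; exact: lt_le_trans.
have cdw i : (i < j.+1)%N -> c * d i ^+ 2 <= w i * e ^+ 2.
  rewrite ltnS leq_eqVlt /d => /orP[/eqP->|ij].
    by rewrite ltnn wj ler_pM2l// -[leRHS]mulr1 expr2 ler_pM2l.
  by rewrite ij expr1n mulr1 cw.
have le1 : \sum_(i < j) x i + e ^+ 2 * \sum_(i < j.+1) x i <=
    2 * \sum_(i < j.+1) d i * x i.
  rewrite !big_ord_recr/= {2}/d ltnn.
  have -> : \sum_(i < j) d i * x i = \sum_(i < j) x i.
    by apply: eq_bigr => i _; rewrite /d ltn_ord mul1r.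
  have s0 : 0 <= \sum_(i < j) x i by rewrite sumr_ge0.
  have := x0 j; nra.
have le2 : \sum_(i < j.+1) m * w i * x i ^+ 2 <=
    \sum_(i < j.+1) (m * w i * x i ^+ 2 / 2 + c * (C *+ 2) ^+ 2 * e ^+ 2 / (2 * m)).
  apply: le_trans H _.
  apply: (@le_trans _ _ (\sum_(i < j.+1) c * (C *+ 2) * d i * x i)); last first.
    by apply: ler_sum => i _; apply: amgm_weight => //; [exact: wgt0|exact: ltW|exact: cdw].
  have -> : \sum_(i < j.+1) c * (C *+ 2) * d i * x i =
      c * (C * (2 * \sum_(i < j.+1) d i * x i)).
    by rewrite !mulr_sumr; apply: eq_bigr => i _; ring.
  by rewrite ler_pM2l// ler_wpM2l.
have le3 : \sum_(i < j.+1) m * w i * x i ^+ 2 <=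
    j.+1%:R * (c * (C *+ 2) ^+ 2 * e ^+ 2 / m).
  move: le2; rewrite big_split/= sumr_const card_ord -mulr_suml -[_ *+ j.+1]mulr_natl.
  have -> : c * (C *+ 2) ^+ 2 * e ^+ 2 / (2 * m) = c * (C *+ 2) ^+ 2 * e ^+ 2 / m / 2.
    by field; rewrite gt_eqF.
  by lra.
have le4 : m * c * x i0 ^+ 2 <= j.+1%:R * (c * (C *+ 2) ^+ 2 * e ^+ 2 / m).
  apply: le_trans le3; rewrite (bigD1 (Ordinal i0j))//= -[leLHS]addr0 lerD//.
    by rewrite ler_wpM2r ?sqr_ge0// ler_pM2l// cw'.
  by rewrite sumr_ge0// => i _; rewrite mulr_ge0 ?sqr_ge0// mulr_ge0 ?ltW ?wgt0.
rewrite -(@ler_pXn2r _ 2)// ?nnegrE//; last first.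
  by rewrite !mulr_ge0 ?invr_ge0 ?mulrn_wge0// ltW.
rewrite -(@ler_pM2l _ (m * c)) ?mulr_gt0//; apply: le_trans le4 _.
(* The spare factor [j.+1] makes the bound a perfect square, avoiding a square root of [j.+1]. *)
have -> : m * c * (j.+1%:R * (C *+ 2) / m * e) ^+ 2 =
   j.+1%:R * (j.+1%:R * (c * (C *+ 2) ^+ 2 * e ^+ 2 / m)).
  by field; rewrite gt_eqF.
rewrite ler_peMl ?ler1n// mulr_ge0// divr_ge0 ?(ltW m0)//.
by rewrite mulr_ge0 ?sqr_ge0// mulr_ge0 ?sqr_ge0 ?(ltW c0).
Qed.

End QuadraticEstimate.

(** * The exponential tilt and convergence at an exponential rate *)

Section Tilting.
Variables (R : realType) (mu : probability R R).

Lemma tilt_normalization_gt0 t :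
  0 < Rintegral mu setT (fun s => expR (2 * t * cos s)).
Proof.
have mc : measurable_fun setT (fun s : R => expR (2 * t * cos s)).
  apply: measurableT_comp => //; apply: measurable_funM => //.
  by apply: continuous_measurable_fun; exact: continuous_cos.
have bnd s : `|2 * t * cos s| <= `|2 * t|.
  by rewrite normrM ler_piMr// cos_max.
apply: (@lt_le_trans _ _ (expR (- `|2 * t|))); first exact: expR_gt0.
have -> : expR (- `|2 * t|) = Rintegral mu setT (fun=> expR (- `|2 * t|)).
  by rewrite Rintegral_cst//= [mu _]probability_setT/= mulr1.
apply: le_Rintegral => //.
- by apply: (@bounded_integrable _ _ _ `|expR (- `|2 * t|)|) => //; exact: measurable_cst.
- apply: (@bounded_integrable _ _ _ (expR `|2 * t|)) => // s.
  by rewrite gtr0_norm ?expR_gt0// ler_expR (le_trans (ler_norm _)).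
- by move=> s _; rewrite ler_expR lerNl (le_trans _ (bnd s))// -normrN ler_norm.
Qed.

Lemma bounded_tilt t : bounded_mfun (fun x => (tilt_density mu t x)%:C).
Proof.
apply: (@bounded_mfun_real _ _
  (expR `|2 * t| / Rintegral mu setT (fun s => expR (2 * t * cos s)))).
  rewrite /tilt_density; apply: measurable_funM => //.
  apply: measurableT_comp => //; apply: measurable_funM => //.
  by apply: continuous_measurable_fun; exact: continuous_cos.
move=> x; rewrite /tilt_density gtr0_norm ?divr_gt0 ?expR_gt0 ?tilt_normalization_gt0//.
rewrite ler_pM2r ?invr_gt0 ?tilt_normalization_gt0// ler_expR.
by rewrite (le_trans (ler_norm _))// normrM ler_piMr// cos_max.
Qed.

Lemma cvgC_pinfty_expR (f : R -> R[i]) L (K d : R) : 0 < d ->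
  (forall t, 0 <= t -> normc (f t - L) <= K * expR (- (t * d))) ->
  cvgC_pinfty f L.
Proof.
move=> d0 H; apply/cvgrPdist_lt => eps eps0; near=> t.
have t0 : 0 < t by near: t; apply: nbhs_pinfty_gt; exact: num_real.
rewrite sub0r normrN ger0_norm ?normc_ge0//.
apply: le_lt_trans (H t (ltW t0)) _.
have td : 0 < t * d by rewrite mulr_gt0.
rewrite expRN ltr_pdivrMr ?expR_gt0//.
(* The linear lower bound of the exponential already beats the constant [K / eps]. *)
apply: (@lt_le_trans _ _ (eps * (1 + t * d))); last by rewrite ler_pM2l// expR_ge1Dx.
have : (`|K| + 1) / (eps * d) < t by near: t; apply: nbhs_pinfty_gt; exact: num_real.
rewrite ltr_pdivrMr ?mulr_gt0// => h.
apply: le_lt_trans (ler_norm K) _; nra.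
Unshelve. all: by end_near. Qed.

End Tilting.

(** * Convergence of [Phi] at [0] to a candidate limit polynomial *)

Section Asymptotics.
Variables (R : realType) (mu : probability R R) (th : nat -> R).
Hypothesis mu1 : mu (`]- pi, pi]%classic : set R) = 1%E.
Hypothesis th_inj : injective th.
Hypothesis th_range : range th =
  [set x : R | [/\ - pi < x <= pi, `|x| < Theta mu & supp mu (expi x)]].
Hypothesis th_nondec : forall k, `|th k| <= `|th k.+1|.

Let z k := expi (th k).
Let z_inj : injective z := expi_th_inj th_inj th_range.
Let m_gt0 k : 0 < mass mu th k := mass_gt0 mu1 th_inj th_range th_nondec k.

Lemma circle_bound n : exists2 C : R, 0 <= C &
  forall (p : {poly R[i]}) x, (size p <= n.+1)%N ->
    normc p.[expi x] <= C * \sum_(i < n.+1) normc p.[z i].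
Proof. by apply: lagrange_bound => // p; have [] := bounded_mfun_horner p. Qed.

Section Estimate.
Variables (j N : nat) (P : {poly R[i]}) (C1 : R).
Hypothesis P_monic : P \is monic.
Hypothesis P_size : size P = j.+2.
Hypothesis jN : (j < N)%N.
Hypothesis N_strict : forall i, (i < N)%N -> `|th i| < `|th N|.
Hypothesis P_root : forall i, (i < j)%N -> P.[z i] = 0.
Hypothesis C1_ge0 : 0 <= C1.
Hypothesis P_atoms : forall r : {poly R[i]}, (size r <= j.+1)%N ->
  normc (\sum_(i < N) (mass mu th i)%:C * ((r.[z i])^* * P.[z i]))
    <= C1 * \sum_(i < j) normc r.[z i].

(** Here [j, ..., N - 1] index the atoms at the level of [th j], [c] is their common weight, and
    [e ^+ 2] bounds the weight ratio from this level to the closer atoms and from the tail to this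
    level. [P_atoms] encodes the orthogonality of [P] on the level. [K] must not depend on [w],
    since [t] will vary. *)
Lemma Phi_estimate : exists K : R, forall (w : R -> R) (c e : R),
  bounded_mfun (fun x => (w x)%:C) -> (forall x, 0 < w x) -> 0 < c ->
  0 < e <= 1 -> (forall i, (i < j)%N -> c <= w (th i) * e ^+ 2) ->
  (forall i, (j <= i < N)%N -> w (th i) = c) ->
  (forall x, tail_set th N x -> w x <= c * e ^+ 2) ->
  normc ((Phi mu w j.+1).[0] - P.[0]) <= K * e.
Proof.
have [CL CL0 hCL] := circle_bound j.
have [C0 C00 hC0] : exists2 C : R, 0 <= C &
    forall (p : {poly R[i]}) (_ : unit), (size p <= j.+1)%N ->
    normc p.[0] <= C * \sum_(i < j.+1) normc p.[z i].
  by apply: (@lagrange_bound _ z z_inj unit (fun=> 0)) => p; exists (normc p.[0]).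
have [_ _ [MP hMP]] := bounded_mfun_horner P.
have MP0 : 0 <= MP by exact: le_trans (normc_ge0 _) (hMP 0).
have [m m0 hm] := exists_lower_bound (n := j.+1) (fun i _ => m_gt0 i).
pose C := C1 + CL * MP *+ 2.
have C_ge0 : 0 <= C by rewrite addr_ge0// mulrn_wge0// mulr_ge0.
exists (C0 * (j.+1%:R * (j.+1%:R * (C *+ 2) / m))) => w c e bw w0 c0 e01 wlow wlev wtail.
have [e0 e1] := andP e01.
have OP := monic_orth_Phi bw w0 mu1 th_inj th_range th_nondec j.+1.
set F := Phi mu w j.+1 in OP *.
have [sF mF _] := OP.
pose q := F - P.
(* Both polynomials are monic of degree [j.+1], so the leading terms cancel. *)
have sq : (size q <= j.+1)%N.
  apply/leq_sizeP => i; rewrite leq_eqVlt => /orP[/eqP <-|ji].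
    have := mF; have := P_monic; rewrite !monicE /lead_coef sF P_size /= => /eqP h1 /eqP h2.
    by rewrite coefB h1 h2 subrr.
  by rewrite coefB !nth_default ?subrr ?sF ?P_size.
pose x i := normc q.[z i].
have x0 i : 0 <= x i by exact: normc_ge0.
pose S := \sum_(i < j.+1) x i.
have S0 : 0 <= S by rewrite sumr_ge0.
have qq : hform mu w q q = - hform mu w q P.
  by rewrite {2}/q hformB// (monic_orth_hform bw OP sq) sub0r.
have ub : normc (hform mu w q P) <= c * (C * (\sum_(i < j) x i + e ^+ 2 * S)).
  rewrite (hform_atoms bw mu1 th_inj th_range th_nondec _ _ N_strict).
  rewrite (le_trans (le_normcD _ _))//.
  (* Below [j] the terms vanish at the roots of [P]; from [j] on the weight is the constant [c] and
     factors out, so [P_atoms] applies. *)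
  have -> : \sum_(i < N) (mass mu th i)%:C *
      ((w (th i))%:C * (q.[expi (th i)])^* * P.[expi (th i)]) =
      c%:C * \sum_(i < N) (mass mu th i)%:C * ((q.[z i])^* * P.[z i]).
    rewrite mulr_sumr; apply: eq_bigr => i _; rewrite -/(z i).
    have [ij|ji] := ltnP i j; first by rewrite P_root// !mulr0.
    by rewrite wlev ?ji ?ltn_ord// -!mulrA mulrCA.
  (* On the tail [w <= c * e ^+ 2], [|q| <= CL * S] by interpolation, and [|P| <= MP]. *)
  have T : normc (Cintegral mu (fun x => (\1_(tail_set th N) x)%:C *
      ((w x)%:C * (q.[expi x])^* * P.[expi x]))) <= (c * e ^+ 2 * (CL * S) * MP) *+ 2.
    have M0 : 0 <= c * e ^+ 2 * (CL * S) * MP.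
      by rewrite mulr_ge0// mulr_ge0// mulr_ge0// ?sqr_ge0// ltW.
    apply: normc_Cintegral_le.
      apply: bounded_mfunM; last exact: bounded_hform.
      apply: (@bounded_mfun_real _ _ 1).
        by apply: measurable_indic; exact: measurable_tail_set.
      by move=> y; rewrite indicE; case: (_ \in _); rewrite ?normr1 ?normr0.
    move=> y; rewrite indicE; case: (boolP (y \in tail_set th N)) => [|_]; last first.
      by rewrite mul0r Normc.normc0.
    rewrite inE => /wtail wy; rewrite mul1r !Normc.normcM normc_conj normc_real.
    rewrite ler_pM ?mulr_ge0 ?normc_ge0// ler_pM ?normc_ge0//.
      by rewrite gtr0_norm.
    exact: hCL.
  apply: le_trans (lerD (lexx _) T) _.
  rewrite Normc.normcM normc_real gtr0_norm//.
  apply: le_trans (lerD (ler_wpM2l (ltW c0) (P_atoms sq)) (lexx _)) _.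
  rewrite /C -/(x _) -subr_ge0.
  have s0 : 0 <= \sum_(i < j) x i by rewrite sumr_ge0.
  rewrite (_ : _ - _ = c * (C1 * (e ^+ 2 * S) + CL * MP *+ 2 * \sum_(i < j) x i)); last first.
    by rewrite /x; ring.
  rewrite mulr_ge0 ?(ltW c0)// addr_ge0//.
    by rewrite mulr_ge0// mulr_ge0// sqr_ge0.
  by rewrite mulr_ge0// mulrn_wge0// mulr_ge0.
(* In the lower bound for [hform q q] only the atoms up to [j] are kept, with masses at least
   [m]. *)
have main : \sum_(i < j.+1) m * w (th i) * x i ^+ 2 <=
    c * (C * (\sum_(i < j) x i + e ^+ 2 * \sum_(i < j.+1) x i)).
  apply: le_trans ub; rewrite -normcN -qq.
  apply: le_trans (le_Re_normc _); apply: le_trans (ler_norm _).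
  apply: le_trans (hform_ge_atoms bw w0 mu1 th_inj th_range th_nondec q N_strict).
  rewrite (big_ord_widen N (fun i => m * w (th i) * x i ^+ 2) jN).
  rewrite big_mkcond/= ler_sum// => i _; case: ifPn => [ij|_].
    by rewrite ler_wpM2r ?sqr_ge0// ler_wpM2r ?(ltW (w0 _))// hm.
  by rewrite mulr_ge0 ?sqr_ge0// mulr_ge0 ?(ltW (w0 _)) ?(ltW (m_gt0 _)).
have xe := quadratic_estimate (w := fun i => w (th i)) m0 c0 C_ge0 e01 x0 wlow
  (wlev j _) main.
rewrite -hornerN -hornerD -/q (le_trans (hC0 q tt sq))// -!mulrA ler_wpM2l//.
apply: (@le_trans _ _ (\sum_(i < j.+1) (j.+1%:R * (C *+ 2) / m * e))).
  by apply: ler_sum => i _; apply: xe; rewrite ?leqnn.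
by rewrite sumr_const card_ord -[leLHS]mulr_natl !mulrA.
Qed.

Hypothesis j_strict : forall i, (i < j)%N -> `|th i| < `|th j|.
Hypothesis N_level : forall i, (j <= i < N)%N -> `|th i| = `|th j|.

(** Tilted weights have ratio [expR (2 * t * (cos x - cos y))], the normalization cancelling. With
    [d] below all relevant cosine gaps, [Phi_estimate] applies with [e = expR (- (t * d))]. *)
Lemma alpha_cvg : cvgC_pinfty (alpha_t mu j) (- (P.[0])^*).
Proof.
have pi_th := norm_th_le_pi th_range.
(* Slots below [j] hold the gaps from the closer atoms to the level of [th j]; slot [j] holds the
   gap from this level to the tail. *)
pose D i := if (i < j)%N then cos (th i) - cos (th j) else cos (th j) - cos (th N).
have [|d d0 hd] := @exists_lower_bound R j.+1 D.
  move=> i _; rewrite /D; case: ifPn => [ij|_]; rewrite subr_gt0 cos_lt_norm//.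
    exact: j_strict.
  exact: N_strict.
have [K hK] := Phi_estimate.
apply: (@cvgC_pinfty_expR _ _ _ K d d0) => t t0.
rewrite /alpha_t /verblunsky -opprB normcN.
have -> : - (P.[0])^* - - ((Phi mu (tilt_density mu t) j.+1).[0])^* =
    ((Phi mu (tilt_density mu t) j.+1).[0] - P.[0])^*.
  by rewrite rmorphB/=; ring.
rewrite normc_conj.
have Z0 := tilt_normalization_gt0 mu t.
pose Z := Rintegral mu setT (fun s => expR (2 * t * cos s)).
have e2 : expR (- (t * d)) ^+ 2 = expR (- (2 * t * d)).
  by rewrite expr2 -expRD; congr expR; ring.
apply: (hK _ (expR (2 * t * cos (th j)) / Z)).
- exact: bounded_tilt.
- by move=> x; rewrite divr_gt0 ?expR_gt0.
- by rewrite divr_gt0 ?expR_gt0.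
- by rewrite expR_gt0 -expR0 ler_expR oppr_le0 mulr_ge0// ltW.
- move=> i ij; rewrite /tilt_density -/Z [leRHS]mulrAC ler_pM2r ?invr_gt0// e2 -expRD ler_expR.
  have := hd i (leqW ij); rewrite /D ij => h.
  have -> : 2 * t * cos (th i) + - (2 * t * d) = 2 * t * (cos (th i) - d) by ring.
  by rewrite ler_wpM2l ?mulr_ge0//; lra.
- move=> i /N_level ij; rewrite /tilt_density -/Z.
  by rewrite -(cos_norm (th i)) ij cos_norm.
- move=> y [ypi yN]; rewrite /tilt_density -/Z [leRHS]mulrAC ler_pM2r ?invr_gt0// e2 -expRD ler_expR.
  have := hd j (ltnSn j); rewrite /D ltnn => h.
  have -> : 2 * t * cos (th j) + - (2 * t * d) = 2 * t * (cos (th j) - d) by ring.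
  have : cos y <= cos (th N) by rewrite cos_le_norm// norm_le_pi.
  by move=> h2; rewrite ler_wpM2l ?mulr_ge0//; lra.
Qed.

End Estimate.
End Asymptotics.

(** * Monic polynomials with prescribed roots at the nodes *)

Section NodalPolynomial.
Variables (R : realType) (z : nat -> R[i]).

Definition nodal n : {poly R[i]} := \prod_(k < n) ('X - (z k)%:P).

Lemma nodal_monic n : nodal n \is monic.
Proof. exact: monic_prod_XsubC. Qed.

Lemma size_nodal n : size (nodal n) = n.+1.
Proof. by rewrite /nodal size_prod_XsubC /index_enum -enumT size_enum_ord. Qed.

Lemma horner_nodal n x : (nodal n).[x] = \prod_(k < n) (x - z k).
Proof. by rewrite /nodal horner_prod; apply: eq_bigr => k _; rewrite hornerXsubC. Qed.

Lemma nodal_root n i : (i < n)%N -> (nodal n).[z i] = 0.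
Proof.
move=> lin; rewrite horner_nodal; apply/eqP/prodf_eq0.
by exists (Ordinal lin); rewrite //= subrr.
Qed.

Lemma nodal_neq0 n i : injective z -> (n <= i)%N -> (nodal n).[z i] != 0.
Proof.
move=> z_inj ni; rewrite horner_nodal; apply/prodf_neq0 => k _.
rewrite subr_eq0; apply/eqP => /z_inj ik; move: ni.
by rewrite ik leqNgt ltn_ord.
Qed.

End NodalPolynomial.

(** * The limits for a single node and for a conjugate pair *)

Section Limits.
Variables (R : realType) (mu : probability R R) (th : nat -> R).
Hypothesis mu1 : mu (`]- pi, pi]%classic : set R) = 1%E.
Hypothesis th_inj : injective th.
Hypothesis th_range : range th =
  [set x : R | [/\ - pi < x <= pi, `|x| < Theta mu & supp mu (expi x)]].
Hypothesis th_nondec : forall k, `|th k| <= `|th k.+1|.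

Let z k := expi (th k).
Let z_inj : injective z := expi_th_inj th_inj th_range.
Let m_gt0 k : 0 < mass mu th k := mass_gt0 mu1 th_inj th_range th_nondec k.

Lemma conj_nodal0 n : ((nodal z n).[0]^*)%R = \prod_(k < n) (- expi (- th k)).
Proof.
rewrite horner_nodal rmorph_prod; apply: eq_bigr => k _.
by rewrite sub0r rmorphN /= expiN.
Qed.

(** The level consists of [th j] alone, so [P = nodal z j.+1] vanishes at every atom before the tail
    and [P_atoms] holds with constant [0]. *)
Lemma alpha_cvg_simple j : (forall i : nat, j = i.+1 -> `|th i| < `|th j|) ->
  `|th j| < `|th j.+1| ->
  cvgC_pinfty (alpha_t mu j) (- 1 * \prod_(k < j.+1) (- expi (- th k))).
Proof.
move=> jlow jup; rewrite mulN1r -conj_nodal0.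
have H := norm_th_homo th_nondec.
apply: (alpha_cvg mu1 th_inj th_range th_nondec (N := j.+1) (C1 := 0)) => //.
- exact: nodal_monic.
- exact: size_nodal.
- by move=> i; rewrite ltnS => /H /le_lt_trans; apply.
- by move=> i ij; rewrite nodal_root// ltnW.
- move=> r _; rewrite mul0r big1 ?Normc.normc0// => i _.
  by rewrite nodal_root// !mulr0.
- case: j {jup} jlow => // j /(_ j erefl) jlow i.
  by rewrite ltnS => /H /le_lt_trans; apply.
- by move=> i; rewrite ltnS -eqn_leq => /eqP ->.
Qed.

(** The level is the pair [th j], [th j.+1 = - th j]. The balance equation says that
    [Q * ('X - zeta)] is orthogonal to [Q = nodal z j] on these two nodes, where [zeta] is the mean
    of the nodes with weights [a] and [1 - a]. *)
Lemma alpha_cvg_double j (a : R) : `|th j| = `|th j.+1| ->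
  (mass mu th j * normc (nodal z j).[z j] ^+ 2) * (1 - a) =
    (mass mu th j.+1 * normc (nodal z j).[z j.+1] ^+ 2) * a ->
  cvgC_pinfty (alpha_t mu j)
    ((\prod_(k < j) (- expi (- th k))) * (a%:C * expi (- th j) + (1 - a)%:C * expi (th j))).
Proof.
move=> jj balance.
have H := norm_th_homo th_nondec.
have thS : th j.+1 = - th j.
  by rewrite (norm_th_eq th_inj _ jj) ?opprK// ltn_eqF.
set Q := nodal z j in balance *.
pose zeta := a%:C * z j + (1 - a)%:C * z j.+1.
have zetaJ : (zeta^*)%R = a%:C * expi (- th j) + (1 - a)%:C * expi (th j).
  have cM (x : R) (u : R[i]) : ((x%:C * u)^*)%R = x%:C * (u^*)%R.
    by rewrite rmorphM; congr (_ * _); exact: conjc_real.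
  transitivity (((a%:C * z j)^*)%R + (((1 - a)%:C * z j.+1)^*)%R); first exact: rmorphD.
  rewrite !cM /z thS; congr (_ * _ + _ * _); first by rewrite [RHS]expiN.
  by have := expiN (- th j); rewrite opprK.
have -> : (\prod_(k < j) (- expi (- th k))) *
    (a%:C * expi (- th j) + (1 - a)%:C * expi (th j)) =
    - ((Q * ('X - zeta%:P)).[0]^*)%R.
  rewrite -zetaJ -conj_nodal0 hornerM hornerXsubC sub0r mulrN.
  by rewrite (rmorphN Num.conj) opprK [RHS]rmorphM.
have [CL CL0 hCL] := circle_bound th_inj th_range j.
have Qj : Q.[z j] != 0 by exact: nodal_neq0.
set P := Q * _.
apply: (alpha_cvg mu1 th_inj th_range th_nondec (N := j.+2)
  (C1 := mass mu th j.+1 * CL * normc P.[z j.+1])) => //.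
- by rewrite monicMl ?nodal_monic ?monicXsubC.
- by rewrite size_monicM ?nodal_monic ?polyXsubC_eq0// size_XsubC size_nodal addn2.
- move=> i; rewrite ltnS => /H /le_lt_trans; apply.
  by rewrite -jj norm_thSS.
- by move=> i ij; rewrite hornerM nodal_root ?mul0r.
- by rewrite mulr_ge0 ?normc_ge0// mulr_ge0 ?(ltW (m_gt0 _)).
- move=> r sr; rewrite !big_ord_recr/= big1 ?add0r; last first.
    by move=> i _; rewrite hornerM nodal_root ?mul0r ?mulr0.
  (* Subtracting [c *: Q], which the orthogonality ignores, makes the remainder [s] vanish at [z j]
     without changing the values below [j]. Interpolation then bounds [s] at [z j.+1] by those
     values alone, which gives the constant [C1]. *)
  pose c := r.[z j] / Q.[z j].
  pose s := r - c *: Q.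
  have ss : (size s <= j.+1)%N.
    rewrite (leq_trans (size_polyD _ _))// geq_max sr size_polyN.
    by rewrite (leq_trans (size_scale_leq _ _))// size_nodal.
  have sj : s.[z j] = 0 by rewrite !hornerE /c divfK ?subrr.
  have si i : (i < j)%N -> s.[z i] = r.[z i].
    by move=> ij; rewrite !hornerE nodal_root// mulr0 subr0.
  have rE u : r.[u] = s.[u] + c * Q.[u] by rewrite !hornerE subrK.
  have cancel : (mass mu th j)%:C * ((Q.[z j])^* * P.[z j]) +
      (mass mu th j.+1)%:C * ((Q.[z j.+1])^* * P.[z j.+1]) = 0.
    have E i : (mass mu th i)%:C * ((Q.[z i])^* * P.[z i]) =
        (mass mu th i * normc Q.[z i] ^+ 2)%:C * (z i - zeta).
      by rewrite hornerM hornerXsubC [X in _ * X]mulrA mulcJ_normc mulrA -rmorphM.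
    rewrite !E /zeta (rmorphB (real_complex R)) (rmorph1 (real_complex R)).
    have := congr1 (real_complex R) balance.
    rewrite !(rmorphM (real_complex R) (_ * _)) (rmorphB (real_complex R) 1).
    rewrite (rmorph1 (real_complex R)) => bal.
    (* The two node differences are [(1 - A) * (u - v)] and [- A * (u - v)], so the balance equation
       cancels them. *)
    have aux (X Y A u v : R[i]) : X * (1 - A) = Y * A ->
        X * (u - (A * u + (1 - A) * v)) + Y * (v - (A * u + (1 - A) * v)) = 0.
      move=> h; transitivity ((X * (1 - A) - Y * A) * (u - v)); first by ring.
      by rewrite h subrr mul0r.
    exact: aux bal.
  have rJ u : ((r.[u])^*)%R = ((s.[u])^*)%R + (c^*)%R * ((Q.[u])^*)%R.
    rewrite rE; transitivity (((s.[u])^*)%R + ((c * Q.[u])^*)%R); first exact: rmorphD.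
    by congr (_ + _); exact: rmorphM.
  rewrite !rJ sj (_ : _ + _ = (mass mu th j.+1)%:C * ((s.[z j.+1])^* * P.[z j.+1]) +
    c^* * ((mass mu th j)%:C * ((Q.[z j])^* * P.[z j]) +
      (mass mu th j.+1)%:C * ((Q.[z j.+1])^* * P.[z j.+1]))); last first.
    by rewrite rmorph0; ring.
  rewrite cancel mulr0 addr0 !Normc.normcM normc_conj normc_real gtr0_norm//.
  have := hCL s (th j.+1) ss; rewrite big_ord_recr/= sj Normc.normc0 addr0 => h.
  have -> : \sum_(i < j) normc r.[z i] = \sum_(i < j) normc s.[z i].
    by apply: eq_bigr => i _; rewrite si.
  by rewrite -!mulrA ler_pM2l// [leRHS]mulrCA [leLHS]mulrC ler_wpM2l ?normc_ge0.
- move=> i ij; rewrite jj (lt_le_trans (norm_thSS th_inj th_nondec i))//.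
  exact: H.
- move=> i /andP[ji]; rewrite ltnS leq_eqVlt ltnS => /orP[/eqP->//|ij].
  by congr `|th _|; apply/eqP; rewrite eqn_leq ij.
Qed.

Lemma normc_nodal n x :
  normc (nodal z n).[x] ^+ 2 = \prod_(k < n) normc (x - z k) ^+ 2.
Proof. by rewrite horner_nodal normc_prod -prodrXl. Qed.

End Limits.


Theorem theorem7p1 (R : realType) (mu : probability R R) (th : nat -> R) :
  (* mu is a probability measure on the circle, parametrized by (-pi, pi] *)
  mu (`]- pi, pi]%classic : set R) = 1%E ->
  (* mu is nontrivial *)
  infinite_set (supp mu) ->
  (* S is infinite *)
  infinite_set [set x : R | [/\ - pi < x <= pi, `|x| < Theta mu & supp mu (expi x)]] ->
  (* th numbers the points of S with nondecreasing |th k| *)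
  injective th ->
  range th = [set x : R | [/\ - pi < x <= pi, `|x| < Theta mu & supp mu (expi x)]] ->
  (forall k, `|th k| <= `|th k.+1|) ->
  (forall j : nat,
     (forall i : nat, j = i.+1 -> `|th i| < `|th j|) ->
     `|th j| < `|th j.+1| ->
     cvgC_pinfty (alpha_t mu j) (- 1 * \prod_(k < j.+1) (- expi (- th k))))
  /\
  (forall j : nat,
     `|th j| = `|th j.+1| ->
     let beta_p := (\prod_(k < j) (Normc.normc (expi (th j) - expi (th k))) ^+ 2)
                   * point_mass mu (expi (th j)) in
     let beta_m := (\prod_(k < j) (Normc.normc (expi (- th j) - expi (th k))) ^+ 2)
                   * point_mass mu (expi (- th j)) in
     let a := beta_p / (beta_p + beta_m) in
     cvgC_pinfty (alpha_t mu j)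
       ((\prod_(k < j) (- expi (- th k)))
        * (a%:C * expi (- th j) + (1 - a)%:C * expi (th j)))).
Proof.
move=> mu1 _ _ th_inj th_range th_nondec; split=> [j|j jj /=].
  exact: alpha_cvg_simple.
(* The mirror point [- th j] is the next node, so [beta_m] involves a genuine atom. *)
have thS : - th j = th j.+1.
  by rewrite (norm_th_eq th_inj _ jj) ?opprK// ltn_eqF.
set bp := (X in X / _); set bm := (X in _ / (_ + X)).
apply: alpha_cvg_double => //.
have m_gt0 := mass_gt0 mu1 th_inj th_range th_nondec.
have pm := point_mass_th th_range.
have -> : mass mu th j * normc (nodal (fun k => expi (th k)) j).[expi (th j)] ^+ 2 = bp.
  by rewrite normc_nodal mulrC /bp pm.
have bmE : mass mu th j.+1 *
    normc (nodal (fun k => expi (th k)) j).[expi (th j.+1)] ^+ 2 = bm.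
  by rewrite normc_nodal mulrC /bm thS pm.
rewrite bmE.
(* Node [j] differs from all earlier nodes and carries mass, so the denominator of [a] is nonzero
   and the balance equation is an identity of fractions. *)
have bp0 : 0 < bp.
  rewrite /bp pm mulr_gt0// prodr_gt0// => k _; rewrite exprn_gt0//.
  rewrite lt_neqAle normc_ge0 andbT eq_sym; apply/eqP => /Normc.eq0_normc/eqP.
  rewrite subr_eq0 => /eqP/(expi_th_inj th_inj th_range) jk.
  by have := ltn_ord k; rewrite -jk ltnn.
have bm0 : 0 <= bm by rewrite -bmE mulr_ge0 ?sqr_ge0 ?(ltW (m_gt0 _)).
have aux (x y : R) : x + y != 0 -> x * (1 - x / (x + y)) = y * (x / (x + y)).
  by move=> xy0; field.
by apply: aux; rewrite gt_eqF// ltr_pwDl.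
Qed.
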